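(* Consider the ODE system $$\frac{d\rho_i}{dt}=\frac{1}{\Delta x^2}\Big\{\sum_{j\in N(i)}\rho_j\,(F_j(\rho)-F_i(\rho))_+-\sum_{j\in N(i)}\rho_i\,(F_i(\rho)-F_j(\rho))_+\Big\},\qquad i\in V. \quad ( * )$$ For any initial condition $\rho^0\in\mathcal{P}_o(G)$, $( * )$ has a unique solution $\rho(t):[0,\infty)\to\mathcal{P}_o(G)$. Moreover: (i) there exists a constant $c=c(\rho^0)>0$, depending on $\rho^0$, such that $\rho_i(t)\ge c$ for all $i\in V$ and $t>0$; (ii) the free energy $\mathcal{F}$ is a Lyapunov function of $( * )$: $$\frac{d}{dt}\mathcal{F}(\rho(t))=-\sum_{(i,j)\in E}\Big(\frac{F_i(\rho)-F_j(\rho)}{\Delta x}\Big)_+^2\rho_i .$$ Further, if $\rho^\infty:=\lim_{t\to\infty}\rho(t)$ exists, then $\rho^\infty$ is a Gibbs measure.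
   Context: $G=(V,E)$ is a finite, undirected, simple, connected graph with $V=\{1,\dots,n\}$; $E$ is a set of ordered pairs containing both $(i,j)$ and $(j,i)$ for each edge (so sums over $(i,j)\in E$ run over both orientations), and $N(i)=\{j\in V:(i,j)\in E\}$. $\Delta x>0$ and $\beta>0$ are constants, $(v_i)_{i=1}^n$ is a real vector, $(w_{ij})_{1\le i,j\le n}$ is a real symmetric matrix, and $(a)_+=\max\{a,0\}$. $\mathcal{P}_o(G)=\{\rho\in\mathbb{R}^n:\sum_i\rho_i=1,\ \rho_i>0\ \forall i\in V\}$. Discrete free energy: $\mathcal{F}(\rho)=\sum_i v_i\rho_i+\frac12\sum_{i,j}w_{ij}\rho_i\rho_j+\beta\sum_i\rho_i\log\rho_i$, and $F_i(\rho)=\frac{\partial}{\partial\rho_i}\mathcal{F}(\rho)=v_i+\sum_j w_{ij}\rho_j+\beta\log\rho_i+\beta$. A (discrete) Gibbs measure is a $\rho^\infty\in\mathcal{P}_o(G)$ satisfying, for all $i\in V$, $$\rho_i^\infty=\frac1K e^{-\frac{v_i+\sum_{j=1}^n w_{ij}\rho_j^\infty}{\beta}},\qquad K=\sum_{i=1}^n e^{-\frac{v_i+\sum_{j=1}^n w_{ij}\rho_j^\infty}{\beta}}.$$ *)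

(* Defs.v *)
From HB Require Import structures.
From mathcomp Require Import all_boot all_order all_algebra.
From mathcomp Require Import all_classical all_reals all_analysis.

Set Implicit Arguments.
Unset Strict Implicit.
Unset Printing Implicit Defensive.

Import Order.TTheory GRing.Theory Num.Theory.
Import numFieldNormedType.Exports.
Local Open Scope classical_set_scope.
Local Open Scope ring_scope.

(* Vertices are 'I_n, densities on the graph are row vectors 'rV[R]_n, and the
   edge set is a relation e : rel 'I_n, so that N(i) = [pred j | e i j] and
   E = {(i, j) | e i j} contains both orientations of each edge. *)

Definition simple_connected_graph (n : nat) (e : rel 'I_n) : Prop :=
  [/\ symmetric e, irreflexive e & forall i j : 'I_n, connect e i j].

Definition pospart (R : realType) (a : R) : R := Num.max a 0.

(* the open probability simplex P_o(G) *)
Definition prob_interior (R : realType) (n : nat) : set 'rV[R]_n :=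
  [set rho | \sum_(i < n) rho 0 i = 1 /\ forall i : 'I_n, 0 < rho 0 i].

Definition free_energy (R : realType) (n : nat) (beta : R)
    (v : 'rV[R]_n) (w : 'M[R]_n) (rho : 'rV[R]_n) : R :=
  \sum_(i < n) v 0 i * rho 0 i
  + 2^-1 * (\sum_(i < n) \sum_(j < n) w i j * rho 0 i * rho 0 j)
  + beta * \sum_(i < n) rho 0 i * ln (rho 0 i).

(* The partial derivative of free_energy in rho_i when w is symmetric and
   rho_i > 0, see is_derive_free_energy. *)
Definition free_energy_grad (R : realType) (n : nat) (beta : R)
    (v : 'rV[R]_n) (w : 'M[R]_n) (i : 'I_n) (rho : 'rV[R]_n) : R :=
  v 0 i + \sum_(j < n) w i j * rho 0 j + beta * ln (rho 0 i) + beta.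

Definition fokker_planck_field (R : realType) (n : nat) (e : rel 'I_n)
    (dx beta : R) (v : 'rV[R]_n) (w : 'M[R]_n) (rho : 'rV[R]_n) : 'rV[R]_n :=
  let F := fun i => free_energy_grad beta v w i rho in
  \row_(i < n) ((dx ^+ 2)^-1 *
    (\sum_(j < n | e i j) rho 0 j * pospart (F j - F i)
     - \sum_(j < n | e i j) rho 0 i * pospart (F i - F j))).

(* l is the derivative at t of f restricted to [0, +oo[: the right derivative
   at t = 0 and the usual derivative at t > 0, see is_derive_halfline_gt0. *)
Definition is_derive_halfline (R : realType) (V : normedModType R)
    (f : R -> V) (t : R) (l : V) : Prop :=
  h^-1 *: (f (t + h) - f t) @[h --> within [set h | 0 <= t + h] (0 : R)^'] --> l.

(* Only the values of rho on [0, +oo[ matter. *)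
Definition fokker_planck_solution (R : realType) (n : nat) (e : rel 'I_n)
    (dx beta : R) (v : 'rV[R]_n) (w : 'M[R]_n) (rho0 : 'rV[R]_n)
    (rho : R -> 'rV[R]_n) : Prop :=
  [/\ rho 0 = rho0,
      forall t, 0 <= t -> prob_interior (rho t)
    & forall t, 0 <= t ->
        is_derive_halfline rho t (fokker_planck_field e dx beta v w (rho t))].

Definition gibbs_measure (R : realType) (n : nat) (beta : R)
    (v : 'rV[R]_n) (w : 'M[R]_n) (rho : 'rV[R]_n) : Prop :=
  let g := fun i => expR (- ((v 0 i + \sum_(j < n) w i j * rho 0 j) / beta)) in
  let K := \sum_(i < n) g i in
  prob_interior rho /\ forall i : 'I_n, rho 0 i = K^-1 * g i.

Lemma is_derive_halfline_gt0 (R : realType) (V : normedModType R)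
    (f : R -> V) (t : R) (l : V) :
  0 < t -> is_derive_halfline f t l <-> is_derive t 1 f l.
Proof.
move=> t0; rewrite /is_derive_halfline.
have -> : within [set h : R | 0 <= t + h] 0^' = 0^'.
  apply/seteqP; split=> A; rewrite /within /=.
    have h0 : \forall h \near (0 : R)^', 0 <= t + h.
      apply: nbhs_dnbhs; near=> h; rewrite -lerBlDl sub0r.
      by rewrite ltW //; near: h; apply: lt_nbhsr; rewrite oppr_lt0.
    by move=> Ah; apply: filterS2 h0 Ah => h h0 /(_ h0).
  by apply: filterS => h.
have E : (fun h : R => h^-1 *: (f (t + h) - f t)) =
    (fun h => h^-1 *: ((f \o shift t) (h *: 1) - f t)).
  by apply/funext => h /=; rewrite [h *: 1]mulr1 (addrC t h).
rewrite E; split=> [fl|[df <-]]; last exact: df.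
by split; [apply/cvg_ex; exists l | exact/cvg_lim].
Unshelve. all: by end_near. Qed.

Lemma is_derive_free_energy (R : realType) (n : nat) (beta : R)
    (v : 'rV[R]_n) (w : 'M[R]_n) (rho : 'rV[R]_n) (i : 'I_n) :
  w^T = w -> 0 < rho 0 i ->
  is_derive rho (delta_mx 0 i) (free_energy beta v w)
    (free_energy_grad beta v w i rho).
Proof.
move=> wS rhoi0.
have coordP j : is_derive rho (delta_mx 0 i) (fun r : 'rV[R]_n => r 0 j)
    (i == j)%:R.
  have did : derivable (@id 'rV[R]_n) rho (delta_mx 0 i) by exact: derivable_id.
  split; first by have /derivable_mxP/(_ 0 j) := did.
  have := derive_mx did; rewrite derive_id => /matrixP/(_ 0 j).
  by rewrite !mxE eqxx /= eq_sym => <-.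
have sumP (h : 'I_n -> 'rV[R]_n -> R) (dh : 'I_n -> R) :
    (forall j, is_derive rho (delta_mx 0 i) (h j) (dh j)) ->
    is_derive rho (delta_mx 0 i) (fun r => \sum_(j < n) h j r)
      (\sum_(j < n) dh j).
  move=> /is_derive_sum; congr (is_derive _ _ _ _).
  by apply/funext => r; rewrite fct_sumE.
have entP j : is_derive rho (delta_mx 0 i) (fun r => r 0 j * ln (r 0 j))
    ((i == j)%:R * (ln (rho 0 j) + 1)).
  set f := (fun r : 'rV[R]_n => _).
  set g := fun h : R => f (h *: delta_mx 0 i + rho).
  have E : (fun h : R => h^-1 *: ((f \o shift rho) (h *: delta_mx 0 i) - f rho))
      = (fun h : R => h^-1 *: ((g \o shift (0 : R)) (h *: 1) - g 0)).
    apply/funext => h; rewrite /g /= scale0r add0r addr0.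
    by rewrite [h *: 1]mulr1.
  suff [dg eg] : is_derive (0 : R) 1 g ((i == j)%:R * (ln (rho 0 j) + 1)).
    by split; [rewrite /derivable E | rewrite /derive E].
  have [eij|ij] := eqVneq i j; last first.
    rewrite mul0r; have -> : g = cst (f rho); last exact: is_derive_cst.
    apply/funext => h; rewrite /g /f !mxE eqxx /= eq_sym (negbTE ij).
    by rewrite mulr0 add0r.
  rewrite -eij; have -> : g = (shift (rho 0 i)) * (@ln R \o shift (rho 0 i)).
    by apply/funext => h; rewrite /g /f !mxE -eij !eqxx /= mulr1.
  have dl : is_derive (shift (rho 0 i) 0) 1 (@ln R) (rho 0 i)^-1.
    by rewrite /= add0r; exact: is_derive1_ln.
  have ds : is_derive (0 : R) 1 (shift (rho 0 i)) 1.
    by apply: is_derive_eq; rewrite addr0.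
  apply: is_derive_eq (is_deriveM ds (is_derive1_comp dl ds)) _.
  by rewrite /= add0r /GRing.scale /= !mulr1 mul1r divff ?gt_eqF // addrC.
have lin := sumP _ _ (fun j => is_deriveZ (v 0 j) (coordP j)).
have quad := sumP _ _ (fun j => sumP _ _ (fun k =>
  is_deriveM (is_deriveZ (w j k) (coordP j)) (coordP k))).
have ent := is_deriveZ beta (sumP _ _ entP).
have tot := is_deriveD (is_deriveD lin (is_deriveZ 2^-1 quad)) ent.
apply: is_derive_eq tot _.
have pick (a : 'I_n -> R) : \sum_(j < n) a j * (i == j)%:R = a i.
  rewrite (bigD1 i) //= eqxx mulr1 big1 ?addr0 // => j.
  by rewrite eq_sym => /negbTE ->; rewrite mulr0.
rewrite /free_energy_grad /GRing.scale /= /GRing.scale /= pick.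
rewrite [X in _ + beta * X](eq_bigr (fun j => (ln (rho 0 j) + 1) * (i == j)%:R)); last first.
  by move=> j _; rewrite mulrC.
rewrite pick mulrDr mulr1 addrA; congr (_ + _ + _ + _).
rewrite (eq_bigr (fun j => w i j * rho 0 j +
    (\sum_(k < n) w j k * rho 0 k) * (i == j)%:R)); last first.
  move=> j _; rewrite big_split /= (pick (fun k => w j k * rho 0 j)); congr (_ + _).
    by rewrite -[in LHS]wS mxE.
  by rewrite mulr_suml; apply: eq_bigr => k _; rewrite mulrA [_ * w _ _]mulrC.
by rewrite big_split /= pick mulrDr ![2^-1 * _]mulrC -splitr.
Qed.

(* Main.v *)
Require Import Defs.
From mathcomp Require Import all_boot all_order all_algebra.
From mathcomp Require Import all_classical all_reals all_analysis.
From mathcomp Require Import ring lra.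

(** The vector field is locally Lipschitz on the open simplex but singular at
its boundary, because of the logarithm, so the heart of the matter is a compact
invariant set that stays away from the boundary.

Fix M bounding every |v_i + sum_j w_ij rho_j| on the simplex. If
rho_j <= q * rho_i with beta * ln q <= - 2 M, then the logarithms dominate and
F_j <= F_i: mass can only flow from i to j ([grad_le]). Take the geometric
sequence a_l = level l, proportional to q^l for l < n and of total mass 1. The
invariant set is the set of densities majorized by a: for every set S of
vertices, the mass of S is at most a_0 + ... + a_(|S|-1) = threshold |S|.
When S violates its bound at least as much as every other set does, comparing S
with S minus one of its vertices and with S plus a vertex outside it gives
rho_i >= a_(|S|-1) for i in S and rho_j <= a_|S| for j outside S. The ratio is
q, so all the fluxes across the boundary of S leave S, and the mass of S does
not increase. A maximum principle for finite families of functions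
([max_principle]) turns this into invariance ([sum_y_le]). Majorization by a
forces rho_i >= a_(n-1) =: c, a uniform lower bound ([level_le_y]); and any
given interior density is majorized by a as soon as q is below all its entries.

Composing the field with the coordinatewise truncation to [c, 1] makes it
globally Lipschitz, and Picard iteration then gives a solution for all times
([picard_lindelof]). The barrier argument is insensitive to the truncation, so
the truncated solution never leaves [c, 1] and solves the original system. It
applies just as well to an arbitrary solution, so that uniqueness follows from
uniqueness for the truncated system ([ode_unique]).

The dissipation identity is the chain rule, since F_i is the partial derivative
of the free energy, followed by a summation by parts over the edges, which uses
that the fluxes are antisymmetric ([grad_field]). If rho(t) converges, then the
free energy and its derivative converge as well, and the limit of the derivative
must be 0 ([cvg_derive_eq0]). The dissipation thus vanishes at the limit, so F_i
is the same at both ends of each edge and, the graph being connected, constant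
([dissipation0_grad]). Solving F_i = const for rho_i gives the Gibbs form. *)

Set Implicit Arguments.
Unset Strict Implicit.
Unset Printing Implicit Defensive.

Import Order.TTheory GRing.Theory Num.Theory.
Import numFieldNormedType.Exports.
Local Open Scope classical_set_scope.
Local Open Scope ring_scope.

(** * Coordinates and half-line derivatives *)

Lemma eq_ler (R : realType) (x y : R) : x = y -> x <= y.
Proof. by move->. Qed.

Lemma ler_coord_norm (R : realType) n (x : 'rV[R]_n) i : `|x 0 i| <= `|x|.
Proof.
by rewrite [leRHS]/Num.norm /= mx_normrE; apply/bigmax_geP; right => /=; exists (0, i).
Qed.

Lemma row_norm_le (R : realType) n (x : 'rV[R]_n) (M : R) :
  0 <= M -> (forall i, `|x 0 i| <= M) -> `|x| <= M.
Proof.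
move=> M0 xM; rewrite [leLHS]/Num.norm /= mx_normrE; apply/bigmax_leP; split=> //.
by case=> i j _ /=; rewrite (ord1 i).
Qed.

Lemma is_derive_row (R : realType) n (f : R -> 'rV[R]_n) (t : R) (l : 'rV[R]_n) :
  (forall i, is_derive t 1 (fun s => f s 0 i) (l 0 i)) -> is_derive t 1 f l.
Proof.
move=> fl.
have df : derivable f t 1.
  by apply/derivable_mxP => i j; rewrite (ord1 i); have [] := fl j.
split=> //; rewrite derive_mx //; apply/rowP => i; rewrite !mxE.
by have [] := fl i.
Qed.

Lemma is_derive_coord (R : realType) n (f : R -> 'rV[R]_n) (t : R) (l : 'rV[R]_n) i :
  is_derive t 1 f l -> is_derive t 1 (fun s => f s 0 i) (l 0 i).
Proof.
move=> [df <-]; split; first by move/derivable_mxP: df; apply.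
by rewrite derive_mx // mxE.
Qed.

Lemma is_derive_sum_in (R : realType) n (P : pred 'I_n) (h : 'I_n -> R -> R)
    (dh : 'I_n -> R) (t : R) :
  (forall i, is_derive t 1 (h i) (dh i)) ->
  is_derive t 1 (fun s => \sum_(i < n | P i) h i s) (\sum_(i < n | P i) dh i).
Proof.
move=> hdh; rewrite big_mkcond /=.
have -> : (fun s => \sum_(i < n | P i) h i s) =
    \sum_(i < n) (if P i then h i else cst 0).
  apply/funext => s; rewrite fct_sumE big_mkcond /=.
  by apply: eq_bigr => i _; case: ifP.
apply: is_derive_sum => i; case: ifP => _; first exact: hdh.
exact: is_derive_cst.
Qed.

Lemma continuous_is_derive (R : realType) (V : normedModType R) (f : R -> V)
    (t : R) (l : V) : is_derive t 1 f l -> {for t, continuous f}.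
Proof. by case=> /derivable1_diffP/differentiable_continuous. Qed.

Lemma within_continuous_is_derive (R : realType) (V : normedModType R)
    (f df : R -> V) (a b : R) : 0 <= a ->
  (forall t : R, 0 <= t -> is_derive t 1 f (df t)) -> {within `[a, b], continuous f}.
Proof.
move=> a0 fdf; apply: continuous_in_subspaceT => t.
rewrite inE /= in_itv /= => /andP[at_ _].
exact: continuous_is_derive (fdf t (le_trans a0 at_)).
Qed.

(** Extending f to t < 0 by its tangent line at 0, of slope l, turns a one-sided
derivative at 0 into a two-sided one, so that everything below can be stated with
two-sided derivatives at the times t >= 0. *)
Definition linear_ext (R : realType) (V : normedModType R) (f : R -> V) (l : V)
  (t : R) : V := if 0 <= t then f t else f 0 + t *: l.

Lemma linear_ext_ge0 (R : realType) (V : normedModType R) (f : R -> V) (l : V) t :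
  0 <= t -> linear_ext f l t = f t.
Proof. by rewrite /linear_ext => ->. Qed.

Lemma is_derive_linear_ext (R : realType) (V : normedModType R) (f l : R -> V) (t : R) :
  (forall t : R, 0 <= t -> is_derive_halfline f t (l t)) -> 0 <= t ->
  is_derive t 1 (linear_ext f (l 0)) (l t).
Proof.
move=> fl t0; set g := linear_ext f (l 0).
suff gl : h^-1 *: ((g \o shift t) (h *: 1) - g t) @[h --> 0^'] --> l t.
  by split; [apply/cvg_ex; exists (l t) | exact/cvg_lim].
move: (fl t t0) => /cvgrPdist_lt H; apply/cvgrPdist_lt => e e0.
have {}H := H e e0.
move: H; rewrite /within /=; rewrite !near_withinE => H.
have h0 : 0 < t -> \forall h \near (0 : R), 0 <= t + h.
  move=> tp; near=> h; rewrite -lerBlDl sub0r.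
  by rewrite ltW //; near: h; apply: lt_nbhsr; rewrite oppr_lt0.
have [t_eq0|tn0] := eqVneq t 0; last first.
  have tp : 0 < t by rewrite lt_neqAle eq_sym tn0.
  have := h0 tp; apply: filterS2 H => h H h1 hn0.
  rewrite /= [h *: 1]mulr1 /g (addrC h) !linear_ext_ge0 //.
  exact: H.
apply: filterS H => h H hn0.
rewrite /= [h *: 1]mulr1 /g (addrC h) t_eq0 add0r.
have [hp|hp] := leP 0 h.
  by rewrite !linear_ext_ge0 //; have := H hn0; rewrite t_eq0 add0r; apply.
rewrite (linear_ext_ge0 _ _ (lexx 0)) /linear_ext leNgt hp /=.
by rewrite addrAC subrr add0r scalerA mulVf // scale1r subrr normr0.
Unshelve. all: by end_near. Qed.

Lemma is_derive_halflineW (R : realType) (V : normedModType R) (f g : R -> V) (t : R) l :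
  (forall s : R, 0 <= s -> f s = g s) -> 0 <= t ->
  is_derive t 1 f l -> is_derive_halfline g t l.
Proof.
move=> fg t0 [df dfl].
have H : h^-1 *: ((f \o shift t) (h *: 1) - f t) @[h --> 0^'] --> l.
  by rewrite -dfl; exact: df.
apply/cvgrPdist_lt => e e0; move/cvgrPdist_lt : H => /(_ e e0).
rewrite !near_withinE; apply: filterS => h H hn0 /= th.
have := H hn0; rewrite /= [h *: 1]mulr1 (addrC h).
by rewrite !fg.
Qed.

(** * Comparison of derivatives *)

Lemma le_is_derive (R : realType) (f g df dg : R -> R) :
  (forall t : R, 0 <= t -> is_derive t 1 f (df t)) ->
  (forall t : R, 0 <= t -> is_derive t 1 g (dg t)) ->
  (forall t : R, 0 <= t -> df t <= dg t) ->
  forall t : R, 0 <= t -> f t - f 0 <= g t - g 0.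
Proof.
move=> fdf gdg dfg t t0.
have D (s : R) : 0 <= s -> is_derive s 1 (g - f) (dg s - df s).
  by move=> s0; apply: is_deriveB; [exact: gdg | exact: fdf].
have [||s] := @MVT_segment R (g - f) (dg - df) 0 t t0.
- by move=> s; rewrite in_itv /= => /andP[s0 _]; apply: D; exact: ltW.
- exact: within_continuous_is_derive D.
rewrite in_itv /= => /andP[s0 _].
rewrite -[(g - f) t]/(g t - f t) -[(g - f) 0]/(g 0 - f 0).
rewrite -[(dg - df) s]/(dg s - df s) => E.
have : 0 <= (dg s - df s) * (t - 0) by rewrite mulr_ge0 ?subr_ge0 ?dfg.
rewrite -E; lra.
Qed.

(** In the sup norm this is the scalar comparison applied to the coordinates of
f and to their opposites. *)
Lemma le_norm_is_derive (R : realType) n (f df : R -> 'rV[R]_n) (g dg : R -> R) :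
  (forall t : R, 0 <= t -> is_derive t 1 f (df t)) ->
  (forall t : R, 0 <= t -> is_derive t 1 g (dg t)) ->
  (forall t : R, 0 <= t -> `|df t| <= dg t) ->
  forall t : R, 0 <= t -> `|f t - f 0| <= g t - g 0.
Proof.
move=> fdf gdg dfg t t0.
have c0 : forall t : R, 0 <= t -> is_derive t 1 (cst 0 : R -> R) 0.
  by move=> *; exact: is_derive_cst.
have g0 : 0 <= g t - g 0.
  have := le_is_derive c0 gdg (fun t t0 => le_trans (normr_ge0 _) (dfg t t0)) t0.
  by rewrite /cst subrr.
apply: row_norm_le => // i; rewrite !mxE ler_norml.
have fi (s : R) : 0 <= s -> is_derive s 1 (fun t => f t 0 i) (df s 0 i).
  by move=> s0; apply: is_derive_coord; exact: fdf.
have fiN (s : R) : 0 <= s -> is_derive s 1 (- (fun t => f t 0 i)) (- df s 0 i).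
  by move=> s0; apply: is_deriveN; exact: fi.
have bd (s : R) : 0 <= s -> `|df s 0 i| <= dg s.
  by move=> s0; exact: le_trans (ler_coord_norm _ _) (dfg s s0).
have U := le_is_derive fi gdg (fun s s0 => le_trans (ler_norm _) (bd s s0)) t0.
have bdN (s : R) : 0 <= s -> - df s 0 i <= dg s.
  by move=> /bd; apply: le_trans; rewrite -normrN ler_norm.
have L := le_is_derive fiN gdg bdN t0.
by move: L; rewrite !opprfctE => L; apply/andP; split; lra.
Qed.

(** * Global solutions of Lipschitz systems *)

Lemma exists_half_exp_lt (R : realType) (B d : R) :
  0 < d -> exists k : nat, B * 2^-1 ^+ k < d.
Proof.
move=> d0; have h1 : `|2^-1 : R| < 1 by rewrite ger0_norm ?invf_lt1 ?invr_ge0 ?ltr1n.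
have /cvgrPdist_lt /(_ d d0) [k _ kP] := cvg_geometric B h1.
exists k; have := kP k (leqnn k); rewrite /= sub0r normrN.
exact: le_lt_trans (ler_norm _).
Qed.

Lemma le0_geometric (R : realType) (a B : R) :
  (forall k, a <= B * 2^-1 ^+ k) -> a <= 0.
Proof.
move=> aB; rewrite leNgt; apply/negP => /(exists_half_exp_lt B) [k].
by rewrite ltNge aB.
Qed.

(** The bound on the distance to the limit is the tail of the geometric series. *)
Lemma geometric_cauchy (R : realType) n (u : nat -> 'rV[R]_n) (B : R) :
  (forall k, `|u k.+1 - u k| <= B * 2^-1 ^+ k) ->
  exists l : 'rV[R]_n, forall k, `|l - u k| <= 2 * B * 2^-1 ^+ k.
Proof.
move=> uB.
have B0 : 0 <= B.
  by have := le_trans (normr_ge0 _) (uB 0%N); rewrite expr0 mulr1.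
have p0 k : 0 <= 2^-1 ^+ k :> R by rewrite exprn_ge0 // invr_ge0.
have um k m : `|u (k + m)%N - u k| <= 2 * B * 2^-1 ^+ k * (1 - 2^-1 ^+ m).
  elim: m => [|m IH]; first by rewrite addn0 subrr normr0 expr0 subrr mulr0.
  rewrite addnS; apply: le_trans (ler_distD (u (k + m)%N) _ _) _.
  apply: le_trans (lerD (uB _) IH) _.
  by apply: eq_ler; rewrite exprD exprS; field.
have {}um k m : `|u (k + m)%N - u k| <= 2 * B * 2^-1 ^+ k.
  apply: le_trans (um k m) _; rewrite -[leRHS]mulr1.
  by apply: ler_wpM2l; rewrite ?mulr_ge0 // gerBl.
have cu : cvg (u @ \oo).
  apply: cauchy_cvg; apply: cauchy_exP => d d0.
  have [k kd] := exists_half_exp_lt (2 * B) d0.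
  exists (u k), k => // m /= km.
  rewrite -ball_normE /= distrC -(subnKC km).
  exact: le_lt_trans (um _ _) kd.
exists (lim (u @ \oo)) => k; apply/ler_addgt0Pr => d d0.
move/cvgrPdist_lt : cu => /(_ d d0) [m _ mP].
rewrite [leRHS]addrC; apply: le_trans (ler_distD (u (k + m)%N) _ _) _.
by apply: lerD (um _ _); apply/ltW/mP => /=; exact: leq_addl.
Qed.

(** Integrating from -1 rather than from 0 puts t = 0 in the interior of the
domain, so that the fundamental theorem of calculus gives a two-sided derivative
there. *)
Definition primitive (R : realType) n (g : R -> 'rV[R]_n) (t : R) : 'rV[R]_n :=
  let F i x := (\int[lebesgue_measure]_(s in `[-1, x]) g s 0 i)%R in
  \row_i (F i t - F i 0).

Lemma primitive0 (R : realType) n (g : R -> 'rV[R]_n) : primitive g 0 = 0.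
Proof. by apply/rowP => i; rewrite !mxE subrr. Qed.

Lemma is_derive_primitive (R : realType) n (g : R -> 'rV[R]_n) :
  continuous g -> forall t : R, 0 <= t -> is_derive t 1 (primitive g) (g t).
Proof.
move=> cg t t0; apply: is_derive_row => i.
under eq_fun do rewrite mxE.
set f := fun s => g s 0 i.
have cf : continuous f.
  move=> s; apply: (@continuous_comp _ _ _ g (fun M : 'rV[R]_n => M 0 i)).
    exact: cg.
  exact: coord_continuous.
have tt1 : t < t + 1 by rewrite ltrDl.
have intf : lebesgue_measure.-integrable `[-1, t + 1] (EFin \o f).
  apply: continuous_compact_integrable; first exact: segment_compact.
  exact: continuous_subspaceT.
have m1t : -1 < t by rewrite (lt_le_trans _ t0) // ltrN10.
have [dF eF] := continuous_FTC1_closed tt1 intf m1t (cf t).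
rewrite -[g t 0 i]/(f t) -eF derive1E -[X in is_derive _ _ _ X]subr0.
apply: is_deriveB; exact: derivableP.
Qed.

Section Picard.
Context (R : realType) (n : nat) (f : 'rV[R]_n -> 'rV[R]_n) (L : R).
Hypothesis L0 : 0 < L.
Hypothesis fL : forall x y, `|f x - f y| <= L * `|x - y|.

Lemma lipschitz_continuous : continuous f.
Proof.
move=> x; apply/(@cvgrPdist_lt _ _ _ (nbhs x)) => d d0.
near=> y; apply: le_lt_trans (fL _ _) _; rewrite -ltr_pdivlMl //.
near: y; apply: (@cvgr_dist_lt _ _ _ (nbhs x) _ id x); first exact: cvg_id.
by rewrite mulr_gt0 ?invr_gt0.
Unshelve. all: by end_near. Qed.

(** The integrand is evaluated at max(0, s) because the iterates are controlled at
nonnegative times only, whereas the primitive starts at -1. *)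
Fixpoint picard (x0 : 'rV[R]_n) (k : nat) : R -> 'rV[R]_n :=
  if k is k'.+1 then
    fun t => x0 + primitive (fun s => f (picard x0 k' (Num.max 0 s))) t
  else cst x0.

Lemma continuous_max0 : continuous (Num.max 0 : R -> R).
Proof.
move=> t; apply: (@continuous_max _ _ (cst 0) id); first exact: cvg_cst.
exact: cvg_id.
Qed.

Lemma is_derive_affine_primitive (x0 : 'rV[R]_n) (y : R -> 'rV[R]_n) :
  continuous (y \o Num.max 0) -> forall t : R, 0 <= t ->
  is_derive t 1 (fun t => x0 + primitive (fun s => f (y (Num.max 0 s))) t)
    (f (y t)).
Proof.
move=> cy t t0; rewrite -[f (y t)]add0r -{2}(max_r t0).
apply: is_deriveD; apply: (is_derive_primitive _ t0) => s.
apply: (@continuous_comp _ _ _ (y \o Num.max 0) f); first exact: cy.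
exact: lipschitz_continuous.
Qed.

Lemma picard_props x0 k :
  [/\ picard x0 k 0 = x0, continuous (picard x0 k \o Num.max 0)
   & forall t : R, 0 <= t -> is_derive t 1 (picard x0 k.+1) (f (picard x0 k t))].
Proof.
elim: k => [|k [IH0 IHc IHd]].
  have c0 : continuous ((picard x0 0) \o Num.max 0) by move=> t; exact: cvg_cst.
  by split=> // t t0; exact: is_derive_affine_primitive.
have c1 : continuous (picard x0 k.+1 \o Num.max 0).
  move=> t; apply: continuous_comp; first exact: continuous_max0.
  have t0 : 0 <= Num.max 0 t by rewrite le_max lexx.
  exact: continuous_is_derive (IHd _ t0).
split=> //; first by rewrite /= primitive0 addr0.
by move=> t t0; exact: is_derive_affine_primitive.
Qed.

Lemma is_derive_expRM (C t : R) :
  is_derive t 1 (fun t => C * expR (2 * L * t)) (C * (2 * L) * expR (2 * L * t)).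
Proof.
have d1 : is_derive t 1 (fun t => 2 * L * t) (2 * L).
  have := @is_deriveZ _ R R id (2 * L) t 1 _ (is_derive_id t 1).
  by rewrite /GRing.scale /= mulr1.
apply: (is_derive_eq (@is_deriveZ _ R R _ C t 1 _
  (is_derive1_comp (is_derive_expR (2 * L * t)) d1))).
by rewrite /GRing.scale /=; ring.
Qed.

(** The weight expR (2 L t) makes the integral operator of the system a
contraction of ratio 1/2: its derivative is 2 L times itself, whereas f expands
distances by L at most. *)
Lemma weighted_comparison (y z dy dz : R -> 'rV[R]_n) (C : R) :
  y 0 = z 0 -> 0 <= C ->
  (forall t : R, 0 <= t -> is_derive t 1 y (dy t)) ->
  (forall t : R, 0 <= t -> is_derive t 1 z (dz t)) ->
  (forall t : R, 0 <= t -> `|dy t - dz t| <= C * (2 * L) * expR (2 * L * t)) ->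
  forall t : R, 0 <= t -> `|y t - z t| <= C * expR (2 * L * t).
Proof.
move=> yz0 C0 hy hz dyz t t0.
have D (s : R) : 0 <= s -> is_derive s 1 (y - z) (dy s - dz s).
  by move=> s0; apply: is_deriveB; [exact: hy | exact: hz].
have := le_norm_is_derive D (fun s _ => is_derive_expRM C s) dyz t0.
rewrite -[(y - z) t]/(y t - z t) -[(y - z) 0]/(y 0 - z 0) yz0 subrr subr0.
move/le_trans; apply; rewrite gerBl mulr_ge0 // ltW //; exact: expR_gt0.
Qed.

(** The factor 1 / (2 L) makes the derivative of the weight dominate f x0, the
velocity of the first iterate; each further iterate gains a factor 1/2. *)
Lemma picard_step x0 k (t : R) : 0 <= t ->
  `|picard x0 k.+1 t - picard x0 k t| <=
  `|f x0| / (2 * L) * expR (2 * L * t) * 2^-1 ^+ k.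
Proof.
have C0 : 0 <= `|f x0| / (2 * L) by rewrite divr_ge0 ?mulr_ge0 // ltW.
have L20 : 2 * L != 0 by rewrite mulf_neq0 // gt_eqF.
rewrite -mulrA [expR _ * _]mulrC mulrA.
elim: k t => [|k IH] t t0.
  have [p0 _ p1] := picard_props x0 0.
  apply: (@weighted_comparison _ _ (fun=> f x0) (fun=> 0)) => //.
  - by rewrite /= primitive0 addr0.
  - by rewrite expr0 mulr1.
  - move=> s s0; rewrite subr0 expr0 mulr1 divfK // ler_peMr //.
    by rewrite -expR0 ler_expR mulr_ge0 // mulr_ge0 // ltW.
have [p0 _ p1] := picard_props x0 k.
have [q0 _ q1] := picard_props x0 k.+1.
apply: (@weighted_comparison _ _ _ _ _ _ _ q1 p1) => //.
- by rewrite q0 /= primitive0 addr0.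
- by rewrite mulr_ge0 // exprn_ge0 // invr_ge0.
move=> s s0; apply: le_trans (fL _ _) _.
apply: le_trans (ler_wpM2l (ltW L0) (IH s s0)) _.
by apply: eq_ler; rewrite exprS; field; rewrite gt_eqF.
Qed.

(** Picard-Lindelof, on the whole half-line since the weighted contraction
estimate holds at all times. *)
Theorem picard_lindelof (x0 : 'rV[R]_n) : exists y : R -> 'rV[R]_n,
  y 0 = x0 /\ forall t : R, 0 <= t -> is_derive t 1 y (f (y t)).
Proof.
set C := `|f x0| / (2 * L).
have C0 : 0 <= C by rewrite divr_ge0 ?mulr_ge0 // ltW.
have /choice [y yP] : forall t : R, exists l : 'rV[R]_n, 0 <= t -> forall k,
    `|l - picard x0 k t| <= 2 * (C * expR (2 * L * t)) * 2^-1 ^+ k.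
  move=> t; have [t0|t0] := leP 0 t; last by exists 0.
  by have [l lP] := geometric_cauchy (fun k => picard_step x0 k t0); exists l.
(* The convergence is uniform on bounded intervals: three-epsilon argument. *)
have cy : continuous (y \o Num.max 0).
  move=> t; apply/cvgrPdist_lt => d d0.
  set E := 2 * (C * expR (2 * L * (Num.max 0 t + 1))).
  have [k kP] := exists_half_exp_lt E (divr_gt0 d0 (ltr0n _ 3)).
  have yk (s : R) : 0 <= s <= Num.max 0 t + 1 -> `|y s - picard x0 k s| < d / 3%:R.
    move=> /andP[s0 st]; apply: le_lt_trans (yP s s0 k) _.
    apply: le_lt_trans kP; apply: ler_wpM2r; first by rewrite exprn_ge0 // invr_ge0.
    apply: ler_wpM2l => //; apply: ler_wpM2l => //.
    by rewrite ler_expR ler_pM2l // mulr_gt0.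
  have [_ ck _] := picard_props x0 k.
  near=> s.
  have st : Num.max 0 s <= Num.max 0 t + 1.
    apply: ltW; near: s; apply: (cvgr_lt _ (@continuous_max0 t)).
    by rewrite ltrDl.
  have H1 := yk (Num.max 0 t).
  have H2 := yk (Num.max 0 s).
  have H3 : `|picard x0 k (Num.max 0 t) - picard x0 k (Num.max 0 s)| < d / 3%:R.
    by near: s; apply: (cvgr_dist_lt _ _ (ck t)); rewrite divr_gt0.
  move: H1 H2; rewrite !le_max !lexx lerDl ler01 st /= => /(_ isT) H1 /(_ isT) H2.
  rewrite -[ltLHS]/`|y (Num.max 0 t) - y (Num.max 0 s)|.
  have := ler_distD (picard x0 k (Num.max 0 s)) (picard x0 k (Num.max 0 t))
    (y (Num.max 0 s)).
  have := ler_distD (picard x0 k (Num.max 0 t)) (y (Num.max 0 t))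
    (y (Num.max 0 s)).
  rewrite distrC in H2.
  move: H1 H2 H3; lra.
(* One more Picard step applied to the limit y gives a differentiable function z,
   and y = z because the iterates converge to both of them. *)
pose z t := x0 + primitive (fun s => f (y (Num.max 0 s))) t.
have z0 : z 0 = x0 by rewrite /z primitive0 addr0.
have dz := is_derive_affine_primitive x0 cy.
have yz (t : R) : 0 <= t -> y t = z t.
  move=> t0; apply/eqP; rewrite -subr_eq0 -normr_le0.
  apply: (@le0_geometric _ _ (2 * (C * expR (2 * L * t)))) => k.
  have [p0 _ p1] := picard_props x0 k.
  have p10 : picard x0 k.+1 0 = z 0 by rewrite z0 /= primitive0 addr0.
  have H : `|picard x0 k.+1 t - z t| <= C * 2^-1 ^+ k * expR (2 * L * t).
    apply: weighted_comparison p1 dz _ t t0 => //.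
      by rewrite mulr_ge0 // exprn_ge0 // invr_ge0.
    move=> s s0; apply: le_trans (fL _ _) _; rewrite distrC.
    apply: le_trans (ler_wpM2l (ltW L0) (yP s s0 k)) _.
    by apply: eq_ler; ring.
  apply: le_trans (ler_distD (picard x0 k.+1 t) _ _) _.
  apply: le_trans (lerD (yP t t0 k.+1) H) _.
  by apply: eq_ler; rewrite exprS; field.
exists z; split=> // t t0; rewrite -yz //; exact: dz.
Unshelve. all: by end_near. Qed.

(** Iterating the contraction estimate from the a priori bound B halves the
weighted distance at each step; B spares a bootstrap on bounded intervals. *)
Lemma ode_unique (y z : R -> 'rV[R]_n) (B : R) :
  y 0 = z 0 -> (forall t : R, 0 <= t -> `|y t - z t| <= B) ->
  (forall t : R, 0 <= t -> is_derive t 1 y (f (y t))) ->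
  (forall t : R, 0 <= t -> is_derive t 1 z (f (z t))) ->
  forall t : R, 0 <= t -> y t = z t.
Proof.
move=> yz0 yzB dy dz t t0.
have B0 : 0 <= B by exact: le_trans (normr_ge0 _) (yzB 0 (lexx 0)).
have H k (s : R) : 0 <= s -> `|y s - z s| <= B * 2^-1 ^+ k * expR (2 * L * s).
  elim: k s => [|k IH] s s0.
    apply: le_trans (yzB s s0) _; rewrite expr0 mulr1 ler_peMr //.
    by rewrite -expR0 ler_expR mulr_ge0 // mulr_ge0 // ltW.
  apply: weighted_comparison dy dz _ s s0 => //.
    by rewrite mulr_ge0 // exprn_ge0 // invr_ge0.
  move=> s s0; apply: le_trans (fL _ _) _.
  apply: le_trans (ler_wpM2l (ltW L0) (IH s s0)) _.
  by apply: eq_ler; rewrite exprS; field.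
apply/eqP; rewrite -subr_eq0 -normr_le0.
apply: (@le0_geometric _ _ (B * expR (2 * L * t))) => k.
by apply: le_trans (H k t t0) _; rewrite mulrAC.
Qed.

End Picard.

(** * Maximum principle and asymptotics *)

Lemma left_max_is_derive (R : realType) (h : R -> R) (c l : R) :
  0 < c -> is_derive c 1 h l -> (forall s, 0 <= s <= c -> h s <= h c) -> 0 <= l.
Proof.
move=> c0 [dh dhl] hc; rewrite leNgt; apply/negP => l0.
have H : k^-1 *: ((h \o shift c) (k *: 1) - h c) @[k --> 0^'] --> l.
  by rewrite -dhl; exact: dh.
have [r /= r0 rP] := cvgr_lt _ H _ l0.
set k := Num.min (r / 2) c.
have k0 : 0 < k by rewrite lt_min c0 divr_gt0.
have kr : k < r by rewrite gt_min; apply/orP; left; lra.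
have kc : k <= c by rewrite ge_min lexx orbT.
have := rP (- k); rewrite /= sub0r opprK gtr0_norm // oppr_eq0 gt_eqF //.
move=> /(_ kr isT); rewrite ltNge => /negP; apply.
rewrite [_ *: 1]mulr1 /GRing.scale /= mulr_le0 ?invr_le0 ?oppr_le0 ?(ltW k0) //.
by rewrite subr_le0 hc //; apply/andP; split; lra.
Qed.

(** Subtracting eta * t from all the functions makes the sign condition strict: a
positive maximum over [0, t] of the perturbed family would be attained at a
positive time by a member that dominates the others, hence has a negative
derivative there, and it would have been larger just before. *)
Lemma max_principle (R : realType) (I : finType) (g dg : I -> R -> R) :
  (forall i (t : R), 0 <= t -> is_derive t 1 (g i) (dg i t)) ->
  (forall i, g i 0 <= 0) ->
  (forall i (t : R), 0 <= t -> (forall j, g j t <= g i t) -> dg i t <= 0) ->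
  forall i (t : R), 0 <= t -> g i t <= 0.
Proof.
move=> gdg g0 dg_max i t t0; apply/ler_addgt0Pr => d d0; rewrite add0r.
set eta := d / (t + 1).
have t1 : 0 < t + 1 by lra.
have eta0 : 0 < eta by rewrite divr_gt0.
pose h j s := g j s - eta * s.
have dh j (s : R) : 0 <= s -> is_derive s 1 (h j) (dg j s - eta).
  move=> s0; apply: is_deriveB; first exact: gdg.
  have := @is_deriveZ _ R R id eta s 1 _ (is_derive_id s 1).
  by rewrite /GRing.scale /= mulr1.
have /choice [c cP] : forall j, exists c, 0 <= c <= t /\
    forall s, 0 <= s <= t -> h j s <= h j c.
  move=> j; have ch := within_continuous_is_derive (b := t) (lexx 0) (dh j).
  have [c ct cmax] := EVT_max t0 ch.
  by exists c; split=> [|s st]; [rewrite in_itv in ct | apply: cmax; rewrite in_itv].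
have [j _ jP] := @arg_maxP _ _ _ i predT (fun j => h j (c j)) isT.
have [ct cmax] := cP j.
have hj k s : 0 <= s <= t -> h k s <= h j (c j).
  by move=> st; apply: le_trans ((cP k).2 s st) _; exact: jP.
have [hle|hgt] := leP (h j (c j)) 0.
  have : h i t <= 0 by apply: le_trans hle; apply: hj; rewrite t0 lexx.
  rewrite /h subr_le0 => /le_trans; apply.
  rewrite /eta mulrAC ler_pdivrMr //; apply: ler_wpM2l; lra.
have [c0 c_t] := andP ct.
have cpos : 0 < c j.
  rewrite lt_neqAle c0 andbT; apply/eqP => c_eq0.
  by move: hgt; rewrite -c_eq0 /h mulr0 subr0 ltNge g0.
have : 0 <= dg j (c j) - eta.
  apply: left_max_is_derive (dh j _ c0) _ => // s /andP[s0 sc].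
  by apply: cmax; rewrite s0 (le_trans sc).
have : dg j (c j) <= 0.
  apply: dg_max => // k; have := hj k _ ct; rewrite /h; lra.
lra.
Qed.

(** The increment of g over [t, t + 1] is a value of its derivative, and it tends
to 0. *)
Lemma cvg_derive_eq0 (R : realType) (g dg : R -> R) (L l : R) :
  (forall t : R, 0 <= t -> is_derive t 1 g (dg t)) ->
  g t @[t --> +oo] --> L -> dg t @[t --> +oo] --> l -> l = 0.
Proof.
move=> gdg gL dgl; apply/eqP/negP => /negP l0.
have e0 : 0 < `|l| / 4 by rewrite divr_gt0 ?normr_gt0.
have [M [_ MP]] := cvgr_dist_lt _ _ gL _ e0.
have [N [_ NP]] := cvgr_dist_lt _ _ dgl _ e0.
set t := Num.max 0 (Num.max M N) + 1.
have [tM tN t0] : [/\ M < t, N < t & 0 <= t].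
  rewrite /t; split; rewrite ?ltr_pwDr // ?le_max ?lexx ?orbT //.
  by rewrite addr_ge0 // le_max lexx.
have [|||x] := @MVT_segment R g dg t (t + 1).
- by rewrite lerDl.
- move=> x; rewrite in_itv /= => /andP[tx _]; apply: gdg.
  exact: le_trans t0 (ltW tx).
- exact: within_continuous_is_derive gdg.
rewrite in_itv /= => /andP[tx _] E.
have := MP _ tM; have := MP (t + 1); have := NP x (lt_le_trans tN tx).
rewrite /= => H1 /(_ (ltr_pwDr ltr01 (ltW tM))) H2 H3.
have := ler_distD L (g (t + 1)) (g t).
rewrite E addrAC subrr add0r mulr1 [`|g (t + 1) - L|]distrC => H4.
have := ler_normD (l - dg x) (dg x); rewrite subrK.
move: H1 H2 H3 H4; rewrite -normr_gt0 in l0; lra.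
Qed.

(** * Bounded Lipschitz functions and truncation *)

Section BoundedLipschitz.
Context (R : realType) (n : nat).
Implicit Types (f g : 'rV[R]_n -> R).

(** Boundedness is part of the notion because products of Lipschitz functions are
Lipschitz only when the factors are bounded. *)
Definition bounded_lipschitz f := exists2 K : R, 0 <= K &
  forall x y, `|f x| <= K /\ `|f x - f y| <= K * `|x - y|.

Lemma bounded_lipschitz_cst (a : R) : bounded_lipschitz (fun=> a).
Proof.
exists `|a| => // x y; split=> //.
by rewrite subrr normr0 mulr_ge0.
Qed.

Lemma bounded_lipschitzD f g :
  bounded_lipschitz f -> bounded_lipschitz g ->
  bounded_lipschitz (fun x => f x + g x).
Proof.
move=> [K K0 fK] [M M0 gM]; exists (K + M); first exact: addr_ge0.
move=> x y; have [f1 f2] := fK x y; have [g1 g2] := gM x y.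
split; first exact: le_trans (ler_normD _ _) (lerD f1 g1).
rewrite opprD addrACA mulrDl.
exact: le_trans (ler_normD _ _) (lerD f2 g2).
Qed.

Lemma bounded_lipschitzM f g :
  bounded_lipschitz f -> bounded_lipschitz g ->
  bounded_lipschitz (fun x => f x * g x).
Proof.
move=> [K K0 fK] [M M0 gM]; exists (2 * (K * M)); first by rewrite !mulr_ge0.
move=> x y; have [f1 f2] := fK x y; have [g1 g2] := gM x y.
have [f3 _] := fK y x.
split.
  rewrite normrM; apply: le_trans (ler_pM _ _ f1 g1) _ => //.
  by rewrite ler_peMl ?mulr_ge0 // ler1n.
have -> : f x * g x - f y * g y = (f x - f y) * g x + f y * (g x - g y) by ring.
apply: le_trans (ler_normD _ _) _; rewrite !normrM.
apply: le_trans (lerD (ler_pM _ _ f2 g1) (ler_pM _ _ f3 g2)) _ => //.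
by apply: eq_ler; ring.
Qed.

Lemma bounded_lipschitzN f :
  bounded_lipschitz f -> bounded_lipschitz (fun x => - f x).
Proof.
move=> [K K0 fK]; exists K => // x y; have [f1 f2] := fK x y.
by rewrite -opprD !normrN.
Qed.

Lemma bounded_lipschitz_sum (I : Type) (r : seq I) (P : pred I)
    (h : I -> 'rV[R]_n -> R) :
  (forall i, bounded_lipschitz (h i)) ->
  bounded_lipschitz (fun x => \sum_(i <- r | P i) h i x).
Proof.
move=> hB; elim: r => [|i r IH].
  under eq_fun do rewrite big_nil; exact: bounded_lipschitz_cst.
under eq_fun do rewrite big_cons; case: (P i) => //.
exact: bounded_lipschitzD.
Qed.

Lemma bounded_lipschitz_pospart f :
  bounded_lipschitz f -> bounded_lipschitz (fun x => pospart (f x)).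
Proof.
move=> [K K0 fK]; exists K => // x y; have [f1 f2] := fK x y; rewrite /pospart.
have normP (a b : R) : - b <= a -> a <= b -> `|a| <= b.
  by move=> ab ba; rewrite ler_norml ab.
have := ler_norm (f x); have := ler_norm (f x - f y).
have := ler_norm (f y - f x); rewrite distrC => H1 H2 H3.
have K1 : 0 <= K * `|x - y| by rewrite mulr_ge0.
by split; apply: normP; have [] := leP (f x) 0; have [] := leP (f y) 0; lra.
Qed.

Lemma bounded_lipschitz_cvg f (T : Type) (F : set_system T) (FF : ProperFilter F)
    (x : T -> 'rV[R]_n) (l : 'rV[R]_n) :
  bounded_lipschitz f -> x t @[t --> F] --> l -> f (x t) @[t --> F] --> f l.
Proof.
move=> [K K0 fK] xl; apply/cvgrPdist_lt => d d0.
have K1 : 0 < K + 1 by rewrite ltr_wpDl.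
have := @cvgr_dist_lt _ _ _ F FF x l xl _ (divr_gt0 d0 K1).
apply: filterS => t.
rewrite ltr_pdivlMr // => H; apply: le_lt_trans (fK _ _).2 _.
apply: le_lt_trans H; rewrite mulrC; apply: ler_wpM2l => //; lra.
Qed.

Lemma bounded_lipschitz_row (f : 'rV[R]_n -> 'rV[R]_n) :
  (forall i, bounded_lipschitz (fun x => f x 0 i)) ->
  exists2 L : R, 0 < L & forall x y, `|f x - f y| <= L * `|x - y|.
Proof.
move=> fB.
have /choice [K KP] : forall i, exists K : R, 0 <= K /\
    forall x y, `|f x 0 i - f y 0 i| <= K * `|x - y|.
  move=> i; have [K K0 KP] := fB i; exists K; split=> // x y.
  exact: (KP x y).2.
exists (1 + \sum_i K i).
  by rewrite ltr_wpDr // sumr_ge0 // => i _; have [] := KP i.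
move=> x y; apply: row_norm_le => [|i].
  by rewrite mulr_ge0 // addr_ge0 // sumr_ge0 // => i _; have [] := KP i.
rewrite !mxE; apply: le_trans ((KP i).2 x y) _; apply: ler_wpM2r => //.
rewrite (bigD1 i) //= addrCA lerDl addr_ge0 // sumr_ge0 // => j _.
by have [] := KP j.
Qed.

(** Truncation of the coordinates to [c, 1]: it removes the singularity of the
logarithm at 0 and makes the quadratic terms of the field globally Lipschitz. *)
Definition clip (c : R) (x : 'rV[R]_n) : 'rV[R]_n :=
  \row_i Num.max c (Num.min 1 (x 0 i)).

Lemma clip_id (c : R) (x : 'rV[R]_n) :
  (forall i, c <= x 0 i <= 1) -> clip c x = x.
Proof.
move=> xc; apply/rowP => i; rewrite mxE; have /andP[cx x1] := xc i.
by rewrite min_r // max_r.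
Qed.

Lemma clip_bounds (c : R) (x : 'rV[R]_n) i : c <= 1 -> c <= clip c x 0 i <= 1.
Proof. by move=> c1; rewrite mxE le_max lexx ge_max c1 ge_min lexx. Qed.

Lemma clip_dist (c : R) (x y : 'rV[R]_n) i :
  `|clip c x 0 i - clip c y 0 i| <= `|x - y|.
Proof.
rewrite !mxE.
have := ler_coord_norm (x - y) i; rewrite !mxE.
have := ler_norm (x 0 i - y 0 i); have := ler_norm (y 0 i - x 0 i).
rewrite distrC => H1 H2 H3; rewrite ler_norml.
have [] := leP 1 (x 0 i); have [] := leP 1 (y 0 i); have [] := leP c 1;
  have [] := leP c (x 0 i); have [] := leP c (y 0 i) => *; apply/andP; split; lra.
Qed.

Lemma bounded_lipschitz_clip (c : R) i : 0 < c <= 1 ->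
  bounded_lipschitz (fun x => clip c x 0 i).
Proof.
move=> /andP[c0 c1]; exists 1 => // x y; split; last first.
  by rewrite mul1r; exact: clip_dist.
have /andP[H1 H2] := clip_bounds x i c1.
by rewrite ger0_norm // (le_trans (ltW c0)).
Qed.

Lemma ln_lipschitz (c a b : R) : 0 < c -> c <= a -> c <= b ->
  `|ln a - ln b| <= c^-1 * `|a - b|.
Proof.
move=> c0; wlog ab : a b / a <= b => [H ca cb|ca cb].
  have [ab|/ltW ba] := leP a b; first exact: H.
  by rewrite distrC [`|a - b|]distrC; exact: H.
have a0 : 0 < a by apply: lt_le_trans ca.
have b0 : 0 < b by apply: lt_le_trans cb.
rewrite distrC [`|a - b|]distrC [leLHS]ger0_norm ?subr_ge0 ?ler_ln //.
rewrite -ln_div // ger0_norm ?subr_ge0 //.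
have H : ln (b / a) <= b / a - 1.
  have := @le_ln1Dx R (b / a - 1); rewrite addrCA subrr addr0; apply.
  by have := divr_gt0 b0 a0; lra.
apply: le_trans H _; rewrite -(@divff _ a) ?gt_eqF // -mulrBl mulrC.
by apply: ler_wpM2r; rewrite ?subr_ge0 // lef_pV2.
Qed.

Lemma bounded_lipschitz_ln_clip (c : R) i : 0 < c <= 1 ->
  bounded_lipschitz (fun x => ln (clip c x 0 i)).
Proof.
move=> /andP[c0 c1].
have ci : 0 <= c^-1 by rewrite invr_ge0 ltW.
exists c^-1 => // x y.
have /andP[x1 x2] := clip_bounds x i c1; have /andP[y1 y2] := clip_bounds y i c1.
split; last first.
  apply: le_trans (ln_lipschitz c0 x1 y1) _.
  by apply: ler_wpM2l => //; exact: clip_dist.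
have := ln_lipschitz c0 x1 c1; rewrite ln1 subr0 => /le_trans; apply.
rewrite -[leRHS]mulr1; apply: ler_wpM2l => //.
by rewrite ler_norml; apply/andP; split; lra.
Qed.

End BoundedLipschitz.

(** * Regularity of the truncated system *)

Lemma sum_antisym (R : realType) (I : finType) (a : I -> I -> R) :
  (forall i j, a i j = - a j i) -> \sum_i \sum_j a i j = 0.
Proof.
move=> aN; set s := LHS; have : s = - s.
  rewrite {1}/s exchange_big /= /s -sumrN; apply: eq_bigr => i _.
  by rewrite -sumrN; apply: eq_bigr => j _; exact: aN.
lra.
Qed.

Section FokkerPlanck.
Context (R : realType) (n : nat) (e : rel 'I_n) (dx beta : R)
  (v : 'rV[R]_n) (w : 'M[R]_n).
Hypotheses (e_sym : symmetric e) (beta_gt0 : 0 < beta).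

Local Notation F := (free_energy_grad beta v w).
Local Notation field := (fokker_planck_field e dx beta v w).

Lemma bounded_lipschitz_grad_clip (c : R) i : 0 < c <= 1 ->
  bounded_lipschitz (fun x => F i (clip c x)).
Proof.
move=> c01; apply: bounded_lipschitzD; last exact: bounded_lipschitz_cst.
apply: bounded_lipschitzD.
  apply: bounded_lipschitzD; first exact: bounded_lipschitz_cst.
  apply: bounded_lipschitz_sum => j; apply: bounded_lipschitzM.
    exact: bounded_lipschitz_cst.
  exact: bounded_lipschitz_clip.
apply: bounded_lipschitzM; first exact: bounded_lipschitz_cst.
exact: bounded_lipschitz_ln_clip.
Qed.

Lemma bounded_lipschitz_grad_sub (c : R) i j : 0 < c <= 1 ->
  bounded_lipschitz (fun x => F i (clip c x) - F j (clip c x)).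
Proof.
move=> c01; apply: bounded_lipschitzD; first exact: bounded_lipschitz_grad_clip.
by apply: bounded_lipschitzN; exact: bounded_lipschitz_grad_clip.
Qed.

Lemma lipschitz_field_clip (c : R) : 0 < c <= 1 ->
  exists2 L : R, 0 < L &
    forall x y, `|field (clip c x) - field (clip c y)| <= L * `|x - y|.
Proof.
move=> c01; apply: (@bounded_lipschitz_row _ _ (field \o clip c)) => i.
under eq_fun do rewrite /= mxE.
apply: bounded_lipschitzM; first exact: bounded_lipschitz_cst.
apply: bounded_lipschitzD; last apply: bounded_lipschitzN;
  apply: bounded_lipschitz_sum => j; apply: bounded_lipschitzM;
  by [exact: bounded_lipschitz_clip |
      apply: bounded_lipschitz_pospart; exact: bounded_lipschitz_grad_sub].
Qed.

Lemma bounded_lipschitz_free_energy_clip (c : R) : 0 < c <= 1 ->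
  bounded_lipschitz (fun x => free_energy beta v w (clip c x)).
Proof.
move=> c01.
have bc := @bounded_lipschitz_cst R n; have bi i := bounded_lipschitz_clip i c01.
apply: bounded_lipschitzD; first apply: bounded_lipschitzD.
- by apply: bounded_lipschitz_sum => i; exact: bounded_lipschitzM.
- apply: bounded_lipschitzM => //; apply: bounded_lipschitz_sum => i.
  apply: bounded_lipschitz_sum => j; apply: bounded_lipschitzM => //.
  exact: bounded_lipschitzM.
- apply: bounded_lipschitzM => //; apply: bounded_lipschitz_sum => i.
  apply: bounded_lipschitzM => //.
  exact: bounded_lipschitz_ln_clip.
Qed.

Definition dissipation (z : 'rV[R]_n) : R :=
  \sum_(i < n) \sum_(j < n | e i j)
    pospart ((F i z - F j z) / dx) ^+ 2 * z 0 i.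

Lemma bounded_lipschitz_dissipation_clip (c : R) : 0 < c <= 1 ->
  bounded_lipschitz (fun x => dissipation (clip c x)).
Proof.
move=> c01.
apply: bounded_lipschitz_sum => i; apply: bounded_lipschitz_sum => j.
under eq_fun do rewrite expr2.
have H : bounded_lipschitz
    (fun x => pospart ((F i (clip c x) - F j (clip c x)) / dx)).
  apply: bounded_lipschitz_pospart; apply: bounded_lipschitzM; last first.
    exact: bounded_lipschitz_cst.
  exact: bounded_lipschitz_grad_sub.
by apply: bounded_lipschitzM; [exact: bounded_lipschitzM | exact: bounded_lipschitz_clip].
Qed.

(** * Fluxes and direction of the flow *)

(** The net rate at which mass enters i from j, up to the factor dx^-2. *)
Definition flux (z : 'rV[R]_n) (i j : 'I_n) : R :=
  z 0 j * pospart (F j z - F i z) - z 0 i * pospart (F i z - F j z).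

Lemma flux_antisym z i j : flux z i j = - flux z j i.
Proof. by rewrite /flux opprB. Qed.

Lemma fieldE z i : field z 0 i = (dx ^+ 2)^-1 * \sum_(j < n | e i j) flux z i j.
Proof. by rewrite mxE /flux sumrB. Qed.

(** By antisymmetry the fluxes between two vertices of S cancel: the mass of S
changes only through the edges that leave S. *)
Lemma sum_field z (S : {set 'I_n}) :
  \sum_(i in S) field z 0 i =
  (dx ^+ 2)^-1 * \sum_(i in S) \sum_(j < n | (j \notin S) && e i j) flux z i j.
Proof.
under eq_bigr do rewrite fieldE.
rewrite -mulr_sumr; congr (_ * _).
have H : \sum_i \sum_j (if [&& i \in S, j \in S & e i j] then flux z i j else 0) = 0.
  apply: sum_antisym => i j; rewrite andbCA e_sym.
  by case: ifP => _; [exact: flux_antisym | rewrite oppr0].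
rewrite (bigID [in S]) /= addrC big1 ?add0r in H; last first.
  by move=> i /negbTE ->; rewrite big1.
rewrite -[RHS]add0r -[X in X + _]H -big_split /=; apply: eq_bigr => i iS.
rewrite (bigID [in S]) /= iS -big_mkcond /=; congr (_ + _);
  by apply: eq_bigl => j; rewrite andbC.
Qed.

Lemma sum_fieldT z : \sum_(i < n) field z 0 i = 0.
Proof.
have := sum_field z finset.setT; under eq_bigl do rewrite inE.
move=> ->; rewrite big1 ?mulr0 // => i _; rewrite big1 // => j.
by rewrite inE.
Qed.

Lemma sum_field_le0 (z : 'rV[R]_n) (S : {set 'I_n}) : (forall i, 0 <= z 0 i) ->
  (forall i j, i \in S -> j \notin S -> F j z <= F i z) ->
  \sum_(i in S) field z 0 i <= 0.
Proof.
move=> z0 FS; rewrite sum_field mulr_ge0_le0 ?invr_ge0 ?sqr_ge0 //.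
apply: sumr_le0 => i iS; apply: sumr_le0 => j /andP[jS _]; rewrite /flux.
have -> : pospart (F j z - F i z) = 0 by rewrite /pospart max_r // subr_le0 FS.
by rewrite mulr0 sub0r oppr_le0 mulr_ge0 // /pospart le_max lexx orbT.
Qed.

Definition potential_bound : R := \sum_i `|v 0 i| + \sum_i \sum_j `|w i j|.

Lemma potential_le (z : 'rV[R]_n) i : (forall j, 0 <= z 0 j <= 1) ->
  `|v 0 i + \sum_j w i j * z 0 j| <= potential_bound.
Proof.
move=> z1; apply: le_trans (ler_normD _ _) _; apply: lerD.
  by rewrite (bigD1 i) //= lerDl sumr_ge0.
apply: (@le_trans _ _ (\sum_j `|w i j|)); last first.
  by rewrite [leRHS](bigD1 i) //= lerDl; do 2!apply: sumr_ge0 => ? _.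
apply: le_trans (ler_norm_sum _ _ _) _; apply: ler_sum => j _.
have /andP[zj0 zj1] := z1 j.
by rewrite normrM (ger0_norm zj0) -[leRHS]mulr1; apply: ler_wpM2l.
Qed.

(** A density ratio below q creates an entropic force, at least - beta * ln q,
that beats any difference of potentials. *)
Lemma grad_le (q : R) (z : 'rV[R]_n) i j : 0 < q ->
  beta * ln q <= - (2 * potential_bound) ->
  (forall k, 0 < z 0 k <= 1) -> z 0 j <= q * z 0 i -> F j z <= F i z.
Proof.
move=> q0 qM z1 zq.
have z01 k : 0 <= z 0 k <= 1 by have /andP[/ltW -> ->] := z1 k.
have zi : 0 < z 0 i by have /andP[] := z1 i.
have zj : 0 < z 0 j by have /andP[] := z1 j.
have /ler_normlP[H1 H2] := potential_le i z01.
have /ler_normlP[H3 H4] := potential_le j z01.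
have : ln (z 0 j) <= ln q + ln (z 0 i).
  by rewrite -lnM // ler_ln // posrE mulr_gt0.
rewrite -(ler_pM2l beta_gt0) mulrDr /free_energy_grad => H5.
move: H1 H2 H3 H4 H5 qM; lra.
Qed.

(** * The invariant set *)

Section Barrier.
Variable q : R.
Hypotheses (q01 : 0 < q < 1) (qM : beta * ln q <= - (2 * potential_bound)).
Hypothesis n_gt0 : (0 < n)%N.

(** The geometric sequence of ratio q, normalized so that its first n terms sum to
1, and its partial sums. *)
Definition level (k : nat) : R := (1 - q) * q ^+ k / (1 - q ^+ n).

Definition threshold (k : nat) : R := (1 - q ^+ k) / (1 - q ^+ n).

Lemma expq_bounds k : 0 < q ^+ k <= 1.
Proof.
have /andP[q0 q1] := q01.
by rewrite exprn_gt0 //= exprn_ile1 // ltW.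
Qed.

Lemma one_sub_expq_gt0 : 0 < 1 - q ^+ n.
Proof.
have /andP[q0 q1] := q01.
by rewrite subr_gt0 exprn_ilt1 // ?ltW // -lt0n.
Qed.

Lemma thresholdS k : threshold k.+1 = threshold k + level k.
Proof.
by rewrite /threshold /level exprS; field; rewrite gt_eqF // one_sub_expq_gt0.
Qed.

Lemma threshold0 : threshold 0 = 0.
Proof. by rewrite /threshold expr0 subrr mul0r. Qed.

Lemma thresholdn : threshold n = 1.
Proof. by rewrite /threshold divff // gt_eqF // one_sub_expq_gt0. Qed.

Lemma levelS k : level k.+1 = q * level k.
Proof. by rewrite /level exprS; ring. Qed.

Lemma level_gt0 k : 0 < level k.
Proof.
have /andP[q0 q1] := q01; have /andP[qk _] := expq_bounds k.
by rewrite /level divr_gt0 ?mulr_gt0 ?subr_gt0 // -subr_gt0 one_sub_expq_gt0.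
Qed.

Lemma level_bounds k : (k < n)%N -> level n.-1 <= level k <= 1.
Proof.
have /andP[q0 q1] := q01 => kn; apply/andP; split.
  rewrite /level ler_pM2r ?invr_gt0 ?one_sub_expq_gt0 // ler_pM2l ?subr_gt0 //.
  rewrite ler_wiXn2l ?ltW //; first by rewrite -ltnS prednK.
rewrite /level ler_pdivrMr ?one_sub_expq_gt0 // mul1r.
have /andP[_ qk] := expq_bounds k.
have : q ^+ n <= q.
  by rewrite -[leRHS]expr1 ler_wiXn2l // ltW.
have : (1 - q) * q ^+ k <= (1 - q) * 1 by rewrite ler_pM2l // subr_gt0.
lra.
Qed.

(** The system is driven by a surrogate z of the density y, either y itself or its
truncation. What the barrier needs is that z stays in ]0, 1] and that it lies on the
same side as y of every number between the smallest level and 1. *)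
Variables y z : R -> 'rV[R]_n.
Hypothesis dy : forall t : R, 0 <= t -> is_derive t 1 y (field (z t)).
Hypothesis y0_sum : \sum_i y 0 0 i = 1.
Hypothesis y0_q : forall i, q <= y 0 0 i.
Hypothesis z01 : forall (t : R) i, 0 <= t -> 0 < z t 0 i <= 1.
Hypothesis zy : forall (t : R) i (a : R), 0 <= t -> level n.-1 <= a <= 1 ->
  (a <= y t 0 i -> a <= z t 0 i) /\ (y t 0 i <= a -> z t 0 i <= a).

Lemma is_derive_sum_y (S : {set 'I_n}) (t : R) : 0 <= t ->
  is_derive t 1 (fun s => \sum_(i in S) y s 0 i) (\sum_(i in S) field (z t) 0 i).
Proof.
move=> t0; apply: is_derive_sum_in => i; apply: is_derive_coord; exact: dy.
Qed.

Lemma sum_yT (t : R) : 0 <= t -> \sum_i y t 0 i = 1.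
Proof.
move=> t0; have D (s : R) : 0 <= s -> is_derive s 1 (fun s => \sum_i y s 0 i) 0.
  move=> s0; apply: (is_derive_eq _ (sum_fieldT (z s))).
  by apply: is_derive_sum_in => i; apply: is_derive_coord; exact: dy.
have C (s : R) : 0 <= s -> is_derive s 1 (cst 1 : R -> R) 0.
  by move=> _; exact: is_derive_cst.
have := le_is_derive D C (fun _ _ => lexx 0) t0.
have := le_is_derive C D (fun _ _ => lexx 0) t0.
rewrite y0_sum /cst => H1 H2; apply/eqP; rewrite eq_le; apply/andP; split; lra.
Qed.

(** Invariance of the set of densities majorized by the geometric sequence. The
empty and the full set belong to the family, so the comparison of S with its
neighbours needs no special case when |S| = 1 or |S| = n - 1. *)
Lemma sum_y_le (S : {set 'I_n}) (t : R) : 0 <= t ->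
  \sum_(i in S) y t 0 i <= threshold #|S|.
Proof.
move=> t0; rewrite -subr_le0; move: S t t0.
have /andP[q0 q1] := q01.
apply: (@max_principle R _
  (fun (S : {set 'I_n}) t => \sum_(i in S) y t 0 i - threshold #|S|)
  (fun S t => \sum_(i in S) field (z t) 0 i)).
- move=> S t t0; rewrite -[X in is_derive _ _ _ X]subr0.
  by apply: is_deriveB; exact: is_derive_sum_y.
- move=> S; rewrite subr_le0; have [->|/set0Pn[k kS]] := eqVneq S finset.set0.
    by rewrite big_set0 cards0 threshold0.
  have [->|/existsP[j jS]] : S = finset.setT \/ [exists j, j \notin S].
  + case: (boolP [exists j, j \notin S]); first by right.
    rewrite negb_exists => /forallP H; left; apply/setP => j.
    by have := H j; rewrite negbK inE.
  + rewrite cardsT card_ord thresholdn -y0_sum.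
    by under eq_bigl do rewrite inE.
  have Sgt0 : (0 < #|S|)%N by apply/card_gt0P; exists k.
  (* a vertex j outside S keeps at least q of the mass *)
  apply: (@le_trans _ _ (1 - q)).
    rewrite -y0_sum [in leRHS](bigID [in S]) /= -addrA lerDl subr_ge0.
    rewrite (bigD1 j) //=; apply: le_trans (y0_q j) _.
    by rewrite lerDl sumr_ge0 // => i _; apply: le_trans (y0_q i); exact: ltW.
  rewrite /threshold ler_pdivlMr ?one_sub_expq_gt0 //.
  have : q ^+ #|S| <= q by rewrite -[leRHS]expr1 ler_wiXn2l // ltW.
  have /andP[qn _] := expq_bounds n; move=> H.
  have : 0 <= (1 - q) * q ^+ n by rewrite mulr_ge0 ?subr_ge0 ?ltW.
  lra.
move=> S t t0 Smax; apply: sum_field_le0 => [i|i j iS jS].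
  by have /andP[/ltW] := z01 i t0.
have Sn : (#|S| < n)%N.
  rewrite -[ltnRHS](card_ord n) -cardsT; apply: proper_card.
  by apply/properP; split; [exact: finset.subsetT | exists j; rewrite ?inE].
have iP : level #|S|.-1 <= y t 0 i.
  have := Smax (S :\ i)%SET; rewrite (big_setD1 i iS) /= [#|S|](cardsD1 i) iS /=.
  by rewrite add1n thresholdS; lra.
have jP : y t 0 j <= level #|S|.
  have := Smax (j |: S)%SET; rewrite big_setU1 //= cardsU1 jS add1n thresholdS.
  lra.
have Sp : #|S| = #|S|.-1.+1.
  by rewrite prednK //; apply/card_gt0P; exists i.
apply: (grad_le (q := q)) => // [k|]; first exact: z01.
have zi : level #|S|.-1 <= z t 0 i.
  by apply: (zy i t0 _).1 => //; apply: level_bounds; rewrite -Sp ltnW.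
have zj : z t 0 j <= level #|S| by apply: (zy j t0 _).2 => //; exact: level_bounds.
apply: le_trans zj _; rewrite {1}Sp levelS.
by apply: ler_wpM2l => //; exact: ltW.
Qed.

(** All the vertices but i carry at most the threshold of n - 1, which leaves at
least the last level to i. *)
Lemma level_le_y (t : R) i : 0 <= t -> level n.-1 <= y t 0 i.
Proof.
move=> t0; have := sum_y_le (finset.setT :\ i) t0.
have := sum_yT t0; rewrite (bigD1 i) //=.
have := thresholdn; rewrite -{1}(prednK n_gt0) thresholdS.
have -> : #|(finset.setT :\ i)%SET| = n.-1.
  by have := cardsD1 i finset.setT; rewrite cardsT card_ord inE => /(congr1 predn) ->.
rewrite [X in _ -> _ -> X <= _ -> _](eq_bigl (fun j => j != i)); first lra.
by move=> j; rewrite !inE andbT.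
Qed.

End Barrier.
End FokkerPlanck.

(** * Free energy, dissipation and equilibria *)

Section Lyapunov.
Context (R : realType) (n : nat) (e : rel 'I_n) (dx beta : R)
  (v : 'rV[R]_n) (w : 'M[R]_n).
Hypotheses (e_sym : symmetric e) (dx_gt0 : 0 < dx) (beta_gt0 : 0 < beta)
  (w_sym : w^T = w).

Local Notation F := (free_energy_grad beta v w).
Local Notation field := (fokker_planck_field e dx beta v w).

(** The symmetry of w makes the two halves of the derivative of the quadratic
term equal, and the entropy contributes beta * (ln rho_i + 1). *)
Lemma is_derive_free_energy_comp (y : R -> 'rV[R]_n) (t : R) (l : 'rV[R]_n) :
  is_derive t 1 y l -> (forall i, 0 < y t 0 i) ->
  is_derive t 1 (fun s => free_energy beta v w (y s))
    (\sum_i F i (y t) * l 0 i).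
Proof.
move=> yl y0.
have dyi i := is_derive_coord i yl.
have lin := is_derive_sum_in xpredT (fun i => is_deriveZ (v 0 i) (dyi i)).
have quad := is_derive_sum_in xpredT (fun i => is_derive_sum_in xpredT (fun j =>
  is_deriveM (is_deriveZ (w i j) (dyi i)) (dyi j))).
have ent := is_derive_sum_in xpredT (fun i =>
  is_deriveM (dyi i) (is_derive1_comp (is_derive1_ln (y0 i)) (dyi i))).
have tot := is_deriveD (is_deriveD lin (is_deriveZ 2^-1 quad))
  (is_deriveZ beta ent).
apply: is_derive_eq tot _.
rewrite /GRing.scale /= /GRing.scale /=.
have -> : \sum_i \sum_j (w i j * y t 0 i * l 0 j + y t 0 j * (w i j * l 0 i)) =
    2 * \sum_i \sum_j w i j * y t 0 j * l 0 i.
  under eq_bigr do rewrite big_split /=.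
  rewrite big_split /= exchange_big /= mulr_natl mulr2n; congr (_ + _).
    apply: eq_bigr => i _; apply: eq_bigr => j _.
    by rewrite -[in LHS]w_sym mxE.
  by apply: eq_bigr => i _; apply: eq_bigr => j _; ring.
rewrite mulKf ?pnatr_eq0 // mulr_sumr -!big_split /=; apply: eq_bigr => i _.
rewrite /free_energy_grad -mulr_suml mulrA mulfV ?gt_eqF //; ring.
Qed.

(** Summation by parts: P i j is the flow from i to j, and exchanging i and j in
the incoming terms leaves (F_j - F_i) * P i j on each oriented edge. *)
Lemma grad_field (z : 'rV[R]_n) :
  \sum_i F i z * field z 0 i = - dissipation e dx beta v w z.
Proof.
pose P i j := if e i j then z 0 i * pospart (F i z - F j z) else 0.
have fP i : field z 0 i = (dx ^+ 2)^-1 * (\sum_j P j i - \sum_j P i j).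
  rewrite fieldE /flux sumrB /P -!big_mkcond /=; congr (_ * (_ - _)).
  by apply: eq_bigl => j; rewrite e_sym.
have -> : dissipation e dx beta v w z =
    (dx ^+ 2)^-1 * \sum_i \sum_j (F i z - F j z) * P i j.
  rewrite mulr_sumr; apply: eq_bigr => i _; rewrite mulr_sumr big_mkcond /=.
  apply: eq_bigr => j _; rewrite /P; case: ifP => _; last by rewrite !mulr0.
  have dxV : 0 < dx^-1 by rewrite invr_gt0.
  rewrite /pospart; case: (leP (F i z - F j z) 0) => [h|h].
    by rewrite max_r ?pmulr_lle0 // expr2 !(mul0r, mulr0).
  rewrite max_l; last by rewrite ltW // mulr_gt0.
  by field; rewrite gt_eqF.
under eq_bigr do rewrite fP.
have -> : \sum_i \sum_j (F i z - F j z) * P i j =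
    \sum_i F i z * \sum_j P i j - \sum_i F i z * \sum_j P j i.
  under eq_bigr do under eq_bigr do rewrite mulrBl.
  under eq_bigr do rewrite sumrB; rewrite sumrB; congr (_ - _).
    by apply: eq_bigr => i _; rewrite mulr_sumr.
  by rewrite exchange_big /=; apply: eq_bigr => i _; rewrite mulr_sumr.
rewrite -sumrB -mulrN -sumrN mulr_sumr; apply: eq_bigr => i _; ring.
Qed.

Lemma dissipation_ge0_term (z : 'rV[R]_n) i j : (forall i, 0 < z 0 i) ->
  0 <= pospart ((F i z - F j z) / dx) ^+ 2 * z 0 i.
Proof. by move=> z0; rewrite mulr_ge0 ?sqr_ge0 // ltW. Qed.

(** Vanishing of the term of the oriented edge (i, j) gives F_i <= F_j; the reverse
orientation gives the other inequality. *)
Lemma dissipation0_grad (z : 'rV[R]_n) : (forall i, 0 < z 0 i) ->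
  dissipation e dx beta v w z = 0 -> forall i j, connect e i j -> F i z = F j z.
Proof.
move=> z0 D0.
have le i j : e i j -> F i z <= F j z.
  move=> eij.
  have D1 : \sum_(k < n | e i k) pospart ((F i z - F k z) / dx) ^+ 2 * z 0 i = 0.
    apply: (psumr_eq0P _ D0) => // k _; apply: sumr_ge0 => m _.
    exact: dissipation_ge0_term.
  have /eqP := psumr_eq0P (fun k _ => dissipation_ge0_term i k z0) D1 (i := j) eij.
  rewrite mulf_eq0 (gt_eqF (z0 i)) orbF sqrf_eq0 /pospart.
  case: (leP ((F i z - F j z) / dx) 0) => h.
    by move: h; rewrite pmulr_lle0 ?invr_gt0 // subr_le0.
  by rewrite (gt_eqF h).
move=> i j /connectP[p pth ->]; elim: p i pth => [//|k p IH] i /= /andP[eik pth].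
by rewrite -IH //; apply/eqP; rewrite eq_le !le // e_sym.
Qed.

(** Solving F_i = C for z_i gives z_i = A * g_i with A independent of i, and the
total mass 1 identifies A with the inverse of the partition function. *)
Lemma grad_const_gibbs (z : 'rV[R]_n) : prob_interior z ->
  (forall i j, F i z = F j z) -> gibbs_measure beta v w z.
Proof.
move=> zP Fz; have [z1 z0] := zP; split=> // i.
set g := fun i => expR (- ((v 0 i + \sum_j w i j * z 0 j) / beta)).
set A := expR ((F i z - beta) / beta).
have zA j : z 0 j = A * g j.
  rewrite /A /g -expRD -[LHS]lnK ?posrE //; congr expR.
  rewrite (Fz i j) /free_energy_grad; field; exact: lt0r_neq0.
have AK : A * \sum_j g j = 1.
  by rewrite -z1 mulr_sumr; apply: eq_bigr => j _; rewrite zA.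
have K0 : \sum_j g j != 0.
  by apply/eqP => K0; move: AK; rewrite K0 mulr0 => /eqP; rewrite eq_sym oner_eq0.
by rewrite zA -[A](mulfK K0) AK mul1r.
Qed.

End Lyapunov.

(** * Well-posedness and convergence *)

Lemma exists_barrier_ratio (R : realType) n (beta M : R) (r : 'rV[R]_n) :
  0 < beta -> (forall i, 0 < r 0 i) ->
  exists q : R, [/\ 0 < q < 1, beta * ln q <= - M & forall i, q <= r 0 i].
Proof.
move=> b0 r0; pose m : R := \big[Num.min/1]_i r 0 i.
have m0 : 0 < m by apply/bigmin_gtP; split=> // i _; exact: r0.
set E := expR (- M / beta).
have q0 : 0 < Num.min (2^-1) (Num.min E m).
  by rewrite !lt_min m0 expR_gt0 invr_gt0 ltr0n.
exists (Num.min (2^-1) (Num.min E m)); split.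
- rewrite q0 gt_min; apply/orP; left; lra.
- rewrite mulrC -ler_pdivlMr // -[leRHS]expRK ler_ln ?posrE ?expR_gt0 //.
  by rewrite !ge_min lexx orbT.
- by move=> i; rewrite !ge_min bigmin_le_cond // !orbT.
Qed.

Unset Implicit Arguments.

Theorem theorem5 (R : realType) (n : nat) (e : rel 'I_n)
    (dx beta : R) (v : 'rV[R]_n) (w : 'M[R]_n) (rho0 : 'rV[R]_n)
    (graph_e : simple_connected_graph e)
    (dx_gt0 : 0 < dx) (beta_gt0 : 0 < beta) (w_sym : w^T = w)
    (rho0_prob : prob_interior rho0) :
  exists rho : R -> 'rV[R]_n,
    [/\ fokker_planck_solution e dx beta v w rho0 rho,
        (forall rho' : R -> 'rV[R]_n,
           fokker_planck_solution e dx beta v w rho0 rho' ->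
           forall t : R, 0 <= t -> rho' t = rho t),
        (exists2 c : R, 0 < c &
           forall (i : 'I_n) (t : R), 0 < t -> c <= rho t 0 i),
        (forall t : R, 0 <= t ->
           is_derive_halfline (fun s : R => free_energy beta v w (rho s)) t
             (- \sum_(i < n) \sum_(j < n | e i j)
                  pospart ((free_energy_grad beta v w i (rho t)
                            - free_energy_grad beta v w j (rho t)) / dx) ^+ 2
                  * rho t 0 i))
      & (forall rhooo : 'rV[R]_n,
           rho t @[t --> +oo] --> rhooo -> gibbs_measure beta v w rhooo)].
Proof.
have [e_sym _ e_conn] := graph_e; have [rho0_sum rho0_gt0] := rho0_prob.
have n_gt0 : (0 < n)%N.
  case: (posnP n) rho0_sum => // n0; rewrite big1 => [/eqP|i].
    by rewrite eq_sym oner_eq0.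
  by have := ltn_ord i; rewrite [X in (_ < X)%N]n0.
have [q [q01 qM q_le]] :=
  exists_barrier_ratio (2 * potential_bound v w) beta_gt0 rho0_gt0.
pose c := level n q n.-1.
have nP : (n.-1 < n)%N by rewrite prednK.
have c_gt0 : 0 < c by exact: level_gt0.
have c01 : 0 < c <= 1 by rewrite c_gt0; have /andP[] := level_bounds q01 n_gt0 nP.
have c_le1 : c <= 1 by have /andP[] := c01.
have [L L_gt0 fL] := lipschitz_field_clip e dx beta v w c01.
have [rho [rho_0 drho]] := picard_lindelof L_gt0 fL rho0.
(* The truncation fulfils the requirements of the barrier on the surrogate. *)
have clip01 (t : R) i : 0 <= t -> 0 < clip c (rho t) 0 i <= 1.
  move=> _; have /andP[h1 h2] := clip_bounds (rho t) i c_le1.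
  by rewrite (lt_le_trans c_gt0 h1).
have clip_level (t : R) i (a : R) : 0 <= t -> c <= a <= 1 ->
    (a <= rho t 0 i -> a <= clip c (rho t) 0 i) /\
    (rho t 0 i <= a -> clip c (rho t) 0 i <= a).
  move=> _ /andP[ca a1]; rewrite mxE; split=> h.
    by rewrite le_max le_min a1 h orbT.
  by rewrite ge_max ca ge_min h orbT.
have init_sum : \sum_i rho 0 0 i = 1 by rewrite rho_0.
have init_q i : q <= rho 0 0 i by rewrite rho_0.
have rho_sum := sum_yT e_sym drho init_sum.
have rho_ge := level_le_y e_sym beta_gt0 q01 qM n_gt0 drho init_sum init_q
  clip01 clip_level.
have le1 (x : 'rV[R]_n) i : (forall j, c <= x 0 j) -> \sum_j x 0 j = 1 -> x 0 i <= 1.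
  move=> xc <-; rewrite (bigD1 i) //= lerDl sumr_ge0 // => j _.
  by apply: le_trans (xc j); exact: ltW.
have rho_le1 (t : R) i : 0 <= t -> rho t 0 i <= 1.
  by move=> t0; apply: le1 => [j|]; [exact: rho_ge | exact: rho_sum].
have rho_clip (t : R) : 0 <= t -> clip c (rho t) = rho t.
  by move=> t0; apply: clip_id => i; rewrite rho_ge // rho_le1.
have rho_gt0 (t : R) i : 0 <= t -> 0 < rho t 0 i.
  by move=> t0; exact: lt_le_trans c_gt0 (rho_ge _ _ _).
have drho' (t : R) : 0 <= t ->
    is_derive t 1 rho (fokker_planck_field e dx beta v w (rho t)).
  by move=> t0; rewrite -(rho_clip t t0); exact: drho.
have dF (t : R) : 0 <= t -> is_derive t 1 (fun s => free_energy beta v w (rho s))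
    (- dissipation e dx beta v w (rho t)).
  move=> t0; rewrite -grad_field //.
  by apply: is_derive_free_energy_comp => // [|i]; [exact: drho' | exact: rho_gt0].
exists rho; split.
- split=> // t t0.
    by split=> [|i]; [exact: rho_sum | exact: rho_gt0].
  exact: is_derive_halflineW (drho' t t0).
- move=> rho' [rho'_0 rho'_prob drho''] t t0.
  set y := linear_ext rho' (fokker_planck_field e dx beta v w (rho' 0)).
  have yE (s : R) : 0 <= s -> y s = rho' s by exact: linear_ext_ge0.
  have dy (s : R) : 0 <= s ->
      is_derive s 1 y (fokker_planck_field e dx beta v w (y s)).
    move=> s0; rewrite yE //.
    exact: (is_derive_linear_ext
      (l := fun s => fokker_planck_field e dx beta v w (rho' s))).
  have y_0 : y 0 = rho0 by rewrite yE.
  have y_sum (s : R) : 0 <= s -> \sum_i y s 0 i = 1.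
    by move=> s0; rewrite yE //; have [] := rho'_prob s s0.
  have y01 (s : R) i : 0 <= s -> 0 < y s 0 i <= 1.
    move=> s0; have ygt0 j : 0 < y s 0 j.
      by rewrite yE //; have [_] := rho'_prob s s0.
    rewrite ygt0 /= -(y_sum s s0) (bigD1 i) //= lerDl sumr_ge0 // => j _.
    exact: ltW.
  (* The barrier, now with the solution as its own surrogate. *)
  have y_ge : forall s i, 0 <= s -> c <= y s 0 i.
    apply: (level_le_y e_sym beta_gt0 q01 qM n_gt0 dy) => //.
    + by rewrite y_0.
    + by move=> i; rewrite y_0.
  rewrite -yE //; apply: (ode_unique L_gt0 fL (B := 1)) t t0 => //.
  + by rewrite y_0.
  + move=> s s0; apply: row_norm_le => // i; rewrite !mxE ler_norml.
    have /andP[h1 h2] := y01 s i s0; have h3 := rho_gt0 s i s0.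
    by have h4 := rho_le1 s i s0; apply/andP; split; lra.
  + move=> s s0; rewrite clip_id; first exact: dy.
    by move=> i; rewrite y_ge //; have /andP[] := y01 s i s0.
- by exists c => // i t /ltW t0; exact: rho_ge.
- move=> t t0; exact: is_derive_halflineW (dF t t0).
move=> rhooo rho_cvg.
have near0 : \forall t \near +oo, (0 : R) <= t by exact: nbhs_pinfty_ge.
have coord_cvg i : rho t 0 i @[t --> +oo] --> rhooo 0 i.
  apply: (@cvg_comp _ _ _ rho (fun x : 'rV[R]_n => x 0 i) _ _ _ rho_cvg).
  exact: coord_continuous.
have oo_ge i : c <= rhooo 0 i.
  apply: (cvgr_to_ge (coord_cvg i)); apply: filterS near0 => t t0; exact: rho_ge.
have oo_le1 i : rhooo 0 i <= 1.
  apply: (cvgr_to_le (coord_cvg i)); apply: filterS near0 => t t0; exact: rho_le1.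
have clip_oo : clip c rhooo = rhooo by apply: clip_id => i; rewrite oo_ge oo_le1.
(* The trajectory and its limit are fixed by the truncation, so the functions that
   are continuous after truncation converge along the trajectory. *)
have BL_cvg (f : 'rV[R]_n -> R) : bounded_lipschitz (fun x => f (clip c x)) ->
    f (rho t) @[t --> +oo] --> f rhooo.
  move=> fB; rewrite -clip_oo.
  apply: cvg_trans (bounded_lipschitz_cvg _ fB rho_cvg).
  apply: near_eq_cvg; apply: filterS near0 => t t0; by rewrite rho_clip.
have oo_sum : \sum_i rhooo 0 i = 1.
  have H1 : \sum_i rho t 0 i @[t --> +oo] --> \sum_i rhooo 0 i.
    apply: (BL_cvg (fun x => \sum_i x 0 i)).
    by apply: bounded_lipschitz_sum => i; exact: bounded_lipschitz_clip.
  apply/eqP; rewrite eq_le; apply/andP; split.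
    apply: (cvgr_to_le H1); apply: filterS near0 => t t0; by rewrite rho_sum.
  apply: (cvgr_to_ge H1); apply: filterS near0 => t t0; by rewrite rho_sum.
have oo_gt0 i : 0 < rhooo 0 i by exact: lt_le_trans c_gt0 (oo_ge i).
have D0 : dissipation e dx beta v w rhooo = 0.
  apply/eqP; rewrite -oppr_eq0; apply/eqP.
  apply: (cvg_derive_eq0 dF).
    exact: BL_cvg (bounded_lipschitz_free_energy_clip beta v w c01).
  apply: cvgN.
  exact: BL_cvg (bounded_lipschitz_dissipation_clip e dx beta v w c01).
apply: grad_const_gibbs => // i j.
exact: (dissipation0_grad e_sym dx_gt0 oo_gt0 D0).
Qed.
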